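(* Let $A$ be an associative and commutative ring with unit, let $\Gamma=EL_6(A)$, and let $G=EL_2(A)$, regarded as the subgroup of $\Gamma$ in the upper-left corner via $g\mapsto\begin{pmatrix} g&0\\0&I_4\end{pmatrix}$. If $\phi$ is a homogeneous quasi-homomorphism on $\Gamma$, then $\phi(g)=0$ for all $g\in G$.
   Context: For an associative ring $B$ with unit, an elementary matrix in $M_n(B)$ is a matrix whose diagonal entries are $1$ and all of whose off-diagonal entries except at most one are $0$; $EL_n(B)$ is the group generated by all elementary matrices in $M_n(B)$. A quasi-homomorphism on a group $\Gamma$ is a function $\phi\colon\Gamma\to\mathbb{R}$ with $\sup_{g,h\in\Gamma}|\phi(gh)-\phi(g)-\phi(h)|<\infty$; it is homogeneous if $\phi(g^m)=m\,\phi(g)$ for all $g\in\Gamma$ and $m\in\mathbb{Z}$. *)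

(* Defs.v *)
From HB Require Import structures.
From mathcomp Require Import all_boot all_order all_algebra.
From mathcomp Require Import reals.
Set Implicit Arguments. Unset Strict Implicit. Unset Printing Implicit Defensive.
Import Order.TTheory GRing.Theory Num.Theory.
Local Open Scope ring_scope.

Definition elementary_mx (B : pzRingType) (n : nat) (M : 'M[B]_n) : Prop :=
  (forall i, M i i = 1) /\
  (forall i j k l, i != j -> k != l -> M i j != 0 -> M k l != 0 ->
      i = k /\ j = l).

Inductive EL (B : pzRingType) (n : nat) : 'M[B]_n -> Prop :=
  | EL_one : EL (1%:M)
  | EL_elem M : elementary_mx M -> EL M
  | EL_mul M N : EL M -> EL N -> EL (M *m N)
  | EL_inv M N : EL M -> M *m N = 1%:M -> N *m M = 1%:M -> EL N.

Definition is_zpow (B : pzRingType) (n : nat) (g : 'M[B]_n) (m : int)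
    (y : 'M[B]_n) : Prop :=
  match m with
  | Posz k => y = g ^+ k
  | Negz k => y *m (g ^+ k.+1) = 1%:M /\ (g ^+ k.+1) *m y = 1%:M
  end.

Definition quasi_hom (B : pzRingType) (n : nat) (R : realType)
    (phi : 'M[B]_n -> R) : Prop :=
  exists C : R, forall g h, EL g -> EL h ->
    `|phi (g *m h) - phi g - phi h| <= C.

Definition homogeneous (B : pzRingType) (n : nat) (R : realType)
    (phi : 'M[B]_n -> R) : Prop :=
  forall g (m : int) y, EL g -> is_zpow g m y -> phi y = m%:~R * phi g.

Definition corner26 (B : pzRingType) (g : 'M[B]_2) : 'M[B]_6 :=
  block_mx g 0 0 (1%:M : 'M[B]_4).

(* Main.v *)
(** Three dimensions suffice. By Cayley-Hamilton g^n = p + q g with p, q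
    depending only on n and on the trace t of g = (a, b; c, d). A Mennicke-type
    relation with 11 elementary operations, whatever n is, splits g^n into
    X = (p + q a, b; q^2 c, p + q d) and N = (p + q a, q; q b c, p + q d).
    Here N is the n-th power of a matrix conjugate to the companion matrix of
    x^2 - t x + 1, which is conjugate to its inverse, so phi N = 0. On the other
    hand p + q a = a^n modulo b, so up to two more operations X depends only on
    a, b and n. As phi is bounded on elementary matrices, n phi(g) is, up to a
    bound independent of n, a function of (a, b) and n; hence phi(g) depends
    only on the first row of g. Thus phi is invariant under left multiplication
    by lower, and by conjugation also upper, elementary matrices. *)

Require Import Defs.
From HB Require Import structures.
From mathcomp Require Import all_boot all_order all_algebra.
From mathcomp Require Import reals ring lra.
Import Order.TTheory GRing.Theory Num.Theory.
Local Open Scope ring_scope.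

Set Implicit Arguments.
Unset Strict Implicit.
Unset Printing Implicit Defensive.

(** * Homogeneous quasi-homomorphisms on [EL] groups *)

(** The Archimedean property, which turns bounds uniform in an exponent into exact equalities for
    [phi]. *)
Lemma eq0_of_natmul_bounded (R : realType) (x K : R) :
  (forall k : nat, k%:R * `|x| <= K) -> x = 0.
Proof.
move=> h; apply/eqP; apply: contraT => x0.
have xp : 0 < `|x| by rewrite normr_gt0.
have := archi_boundP (_ : 0 <= `|K / `|x| |); rewrite normr_ge0 => /(_ isT).
set k := Num.bound _ => hk.
have := h k; rewrite -ler_pdivlMr // => hk'.
by have := lt_le_trans hk (le_trans hk' (ler_norm _)); rewrite ltxx.
Qed.

Lemma EL_exp (B : pzRingType) (n : nat) (g : 'M[B]_n) (k : nat) :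
  EL g -> EL (g ^+ k).
Proof.
move=> hg; elim: k => [|k ih]; first by rewrite expr0; exact: EL_one.
by rewrite exprS; exact: EL_mul.
Qed.

Lemma conj_exp (B : pzRingType) (n : nat) (g h h' : 'M[B]_n) (k : nat) :
  h' *m h = 1%:M -> h *m h' = 1%:M ->
  (h *m g *m h') ^+ k = h *m g ^+ k *m h'.
Proof.
move=> h'h hh'; elim: k => [|k ih]; first by rewrite !expr0 mulmx1.
by rewrite !exprS ih -!mulmxE -!mulmxA (mulmxA h' h) h'h mul1mx.
Qed.

(** The constant is exposed so that later bounds are visibly uniform in exponents and matrix
    entries. *)
Definition quasi_hom_bound (B : pzRingType) (n : nat) (R : realType)
    (phi : 'M[B]_n -> R) (C : R) : Prop :=
  forall g h, EL g -> EL h -> `|phi (g *m h) - phi g - phi h| <= C.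

Lemma homogeneous_exp (B : pzRingType) (n : nat) (R : realType)
    (phi : 'M[B]_n -> R) (g : 'M[B]_n) (k : nat) :
  homogeneous phi -> EL g -> phi (g ^+ k) = k%:R * phi g.
Proof. by move=> hom hg; rewrite (hom g (Posz k)). Qed.

Lemma homogeneous_inv (B : pzRingType) (n : nat) (R : realType)
    (phi : 'M[B]_n -> R) (g h : 'M[B]_n) :
  homogeneous phi -> EL g -> g *m h = 1%:M -> h *m g = 1%:M ->
  phi h = - phi g.
Proof.
by move=> hom hg gh hg1; rewrite (hom g (Negz 0) h) ?mulN1r.
Qed.

Lemma homogeneous_one (B : pzRingType) (n : nat) (R : realType)
    (phi : 'M[B]_n -> R) : homogeneous phi -> phi 1%:M = 0.
Proof.
move=> hom; have := homogeneous_exp 0 hom (EL_one B n).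
by rewrite expr0 mul0r.
Qed.

(** The k-th power of the conjugate is h g^k h', and the values at h and h' cancel; hence k times
    the difference is at most 2C for every k. *)
Lemma homogeneous_conj (B : pzRingType) (n : nat) (R : realType)
    (phi : 'M[B]_n -> R) (C : R) (g h h' : 'M[B]_n) :
  quasi_hom_bound phi C -> homogeneous phi -> EL g -> EL h ->
  h' *m h = 1%:M -> h *m h' = 1%:M -> phi (h *m g *m h') = phi g.
Proof.
move=> qC hom hg hh h'h hh'.
have eh' : EL h' by exact: EL_inv hh hh' h'h.
apply/eqP; rewrite -subr_eq0; apply/eqP.
apply: (@eq0_of_natmul_bounded _ _ (C + C)) => k.
have e1 : EL (h *m g) by exact: EL_mul.
have ek := EL_exp k hg.
rewrite -[k%:R]ger0_norm // -normrM mulrBr -!homogeneous_exp //; last first.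
  exact: EL_mul.
rewrite conj_exp //.
have q1 := qC _ _ (EL_mul hh ek) eh'.
have q2 := qC _ _ hh ek.
rewrite (homogeneous_inv hom hh hh' h'h) in q1.
move: q1 q2; rewrite !ler_norml => /andP[? ?] /andP[? ?].
by apply/andP; split; lra.
Qed.

(** A commutator is a conjugate of h times the inverse of h; their values cancel, leaving a single
    defect. *)
Lemma homogeneous_commutator (B : pzRingType) (n : nat) (R : realType)
    (phi : 'M[B]_n -> R) (C : R) (g g' h h' : 'M[B]_n) :
  quasi_hom_bound phi C -> homogeneous phi -> EL g -> EL h ->
  g' *m g = 1%:M -> g *m g' = 1%:M -> h' *m h = 1%:M -> h *m h' = 1%:M ->
  `|phi (g *m h *m g' *m h')| <= C.
Proof.
move=> qC hom hg hh g'g gg' h'h hh'.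
have eg' : EL g' by exact: EL_inv hg gg' g'g.
have eh' : EL h' by exact: EL_inv hh hh' h'h.
have := qC (g *m h *m g') h' (EL_mul (EL_mul hg hh) eg') eh'.
rewrite (homogeneous_conj qC hom hh hg g'g gg').
by rewrite (homogeneous_inv hom hh hh' h'h) opprK subrK.
Qed.

(** * Elementary matrices and explicit 3 by 3 matrices *)

Definition transv {A : pzRingType} {n : nat} (i j : 'I_n) (x : A) : 'M[A]_n :=
  1%:M + x *: delta_mx i j.

Lemma transv_EL (A : pzRingType) (n : nat) (i j : 'I_n) (x : A) :
  i != j -> EL (transv i j x).
Proof.
move=> ij; apply: EL_elem.
have nz k l : k != l -> transv i j x k l != 0 -> k = i /\ l = j.
  move=> kl; rewrite !mxE (negbTE kl) add0r.
  by case: (k =P i) => [->|_]; case: (l =P j) => [->|_] //=;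
    rewrite mulr0 eqxx.
split=> [k|k l k' l' kl kl' /(nz _ _ kl)[-> ->] /(nz _ _ kl')[-> ->] //].
rewrite !mxE eqxx; case: (k =P i) => [->|_] /=; last by rewrite mulr0 addr0.
by rewrite (negbTE ij) mulr0 addr0.
Qed.

Lemma transvM (A : pzRingType) (n : nat) (i j : 'I_n) (x y : A) :
  i != j -> transv i j x *m transv i j y = transv i j (x + y).
Proof.
move=> ij; rewrite mulmxDl !mulmxDr !mulmx1 mul1mx -scalemxAl.
rewrite /transv -addrA; congr (_ + _).
have -> : delta_mx i j *m (y *: delta_mx i j) = 0 :> 'M[A]_n.
  apply/matrixP => k l; rewrite !mxE big1 // => m _; rewrite !mxE.
  case: (m =P j) => [->|_]; last by rewrite andbF mul0r.
  by rewrite (eq_sym j i) (negbTE ij) /= !mulr0.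
by rewrite scaler0 addr0 scalerDl addrC.
Qed.

Lemma transv0 (A : pzRingType) (n : nat) (i j : 'I_n) :
  transv i j (0 : A) = 1%:M.
Proof. by rewrite /transv scale0r addr0. Qed.

Lemma transvK (A : pzRingType) (n : nat) (i j : 'I_n) (x : A) :
  i != j -> transv i j (- x) *m transv i j x = 1%:M.
Proof. by move=> ij; rewrite transvM // addNr transv0. Qed.

Lemma transvVK (A : pzRingType) (n : nat) (i j : 'I_n) (x : A) :
  i != j -> transv i j x *m transv i j (- x) = 1%:M.
Proof. by move=> ij; rewrite transvM // subrr transv0. Qed.

(* [elsteps k M N]: N arises from M by k elementary row or column operations. *)
Inductive elsteps (A : pzRingType) (n : nat) :
    nat -> 'M[A]_n -> 'M[A]_n -> Prop :=
  | elsteps_refl M : elsteps 0 M M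
  | elsteps_row k i j x M N :
      i != j -> elsteps k M N -> elsteps k.+1 M (transv i j x *m N)
  | elsteps_col k i j x M N :
      i != j -> elsteps k M N -> elsteps k.+1 M (N *m transv i j x).

(** Listing the nine entries splits every matrix identity into ring identities. *)
Definition mx3 {A : pzRingType} (a b c d e f g h k : A) : 'M[A]_3 :=
  \matrix_(i < 3, j < 3)
    nth 0 (nth [::] [:: [:: a; b; c]; [:: d; e; f]; [:: g; h; k]] i) j.

Lemma mx3_mul (A : pzRingType)
    (a b c d e f g h k a' b' c' d' e' f' g' h' k' : A) :
  mx3 a b c d e f g h k *m mx3 a' b' c' d' e' f' g' h' k' =
  mx3 (a * a' + b * d' + c * g') (a * b' + b * e' + c * h')
      (a * c' + b * f' + c * k')
      (d * a' + e * d' + f * g') (d * b' + e * e' + f * h')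
      (d * c' + e * f' + f * k')
      (g * a' + h * d' + k * g') (g * b' + h * e' + k * h')
      (g * c' + h * f' + k * k').
Proof.
apply/matrixP => i j; rewrite !mxE !big_ord_recl big_ord0 !mxE.
by case: i => [[|[|[|//]]]] ?; case: j => [[|[|[|//]]]] ? /=;
  rewrite addr0 addrA.
Qed.

Lemma mx3_one (A : pzRingType) : 1%:M = mx3 1 0 0 0 1 0 0 0 1 :> 'M[A]_3.
Proof.
by apply/matrixP => -[[|[|[|//]]] ?] [[|[|[|//]]] ?]; rewrite !mxE.
Qed.

Definition i0 : 'I_3 := @Ordinal 3 0 isT.
Definition i1 : 'I_3 := @Ordinal 3 1 isT.
Definition i2 : 'I_3 := @Ordinal 3 2 isT.

Lemma transv_mx3 (A : pzRingType) (x : A) :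
  (transv i0 i1 x = mx3 1 x 0 0 1 0 0 0 1) *
  (transv i0 i2 x = mx3 1 0 x 0 1 0 0 0 1) *
  (transv i1 i0 x = mx3 1 0 0 x 1 0 0 0 1) *
  (transv i1 i2 x = mx3 1 0 0 0 1 x 0 0 1) *
  (transv i2 i0 x = mx3 1 0 0 0 1 0 x 0 1) *
  (transv i2 i1 x = mx3 1 0 0 0 1 0 0 x 1).
Proof.
by do !split; apply/matrixP => -[[|[|[|//]]] ?] [[|[|[|//]]] ?];
  rewrite !mxE /= ?mulr0 ?mulr1 ?addr0 ?add0r.
Qed.

(* The third index makes every elementary 3 x 3 matrix a commutator. *)
Lemma phi_transv (A : comPzRingType) (R : realType) (phi : 'M[A]_3 -> R)
    (C : R) (i j : 'I_3) (x : A) :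
  quasi_hom_bound phi C -> homogeneous phi -> i != j ->
  `|phi (transv i j x)| <= C.
Proof.
move=> qC hom ij.
have [k [ik kj]] : exists k : 'I_3, i != k /\ k != j.
  by case: i ij => [[|[|[|//]]] ?]; case: j => [[|[|[|//]]] ?] // _;
    (exists i0 + exists i1 + exists i2).
have := homogeneous_commutator qC hom (transv_EL x ik) (transv_EL 1 kj)
  (transvK x ik) (transvVK x ik) (transvK 1 kj) (transvVK 1 kj).
suff -> : transv i k x *m transv k j 1 *m transv i k (- x) *m transv k j (- 1)
          = transv i j x by [].
(* Replacing the bound proofs by [isT] turns the indices into [i0], [i1], [i2], so that [transv_mx3]
   applies. *)
case: i ij ik => [[|[|[|//]]] hi]; case: j kj => [[|[|[|//]]] hj];
  case: k => [[|[|[|//]]] hk] // _ _ _;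
  rewrite ?(bool_irrelevance hi isT) ?(bool_irrelevance hj isT)
    ?(bool_irrelevance hk isT) -?/i0 -?/i1 -?/i2 !transv_mx3 !mx3_mul;
  by congr mx3; ring.
Qed.

(** * Chains of elementary operations *)

Lemma elsteps_trans (A : pzRingType) (n k l : nat) (M N P : 'M[A]_n) :
  elsteps k M N -> elsteps l N P -> elsteps (k + l) M P.
Proof.
move=> MN NP; elim: NP MN => {N P l} [N|l i j x N P ij _ ih|l i j x N P ij _ ih]
  MN; first by rewrite addn0.
- by rewrite addnS; apply: elsteps_row => //; exact: ih.
- by rewrite addnS; apply: elsteps_col => //; exact: ih.
Qed.

Lemma elsteps_sym (A : pzRingType) (n k : nat) (M N : 'M[A]_n) :
  elsteps k M N -> elsteps k N M.
Proof.
elim=> {k M N} [M|k i j x M N ij _ ih|k i j x M N ij _ ih].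
- exact: elsteps_refl.
- rewrite -add1n; apply: elsteps_trans ih.
  have := elsteps_row (- x) ij (elsteps_refl (transv i j x *m N)).
  by rewrite mulmxA transvK // mul1mx.
- rewrite -add1n; apply: elsteps_trans ih.
  have := elsteps_col (- x) ij (elsteps_refl (N *m transv i j x)).
  by rewrite -mulmxA transvVK // mulmx1.
Qed.

Lemma elsteps_EL (A : pzRingType) (n k : nat) (M N : 'M[A]_n) :
  elsteps k M N -> EL M -> EL N.
Proof.
elim=> {k M N} [M|k i j x M N ij _ ih|k i j x M N ij _ ih] // hM.
- by apply: EL_mul (transv_EL x ij) (ih hM).
- by apply: EL_mul (ih hM) (transv_EL x ij).
Qed.

(** Each operation costs one defect and one value of [phi] at an elementary matrix, both at most
    C. *)
Lemma phi_elsteps (A : comPzRingType) (R : realType) (phi : 'M[A]_3 -> R)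
    (C : R) (k : nat) (M N : 'M[A]_3) :
  quasi_hom_bound phi C -> homogeneous phi -> elsteps k M N -> EL M ->
  `|phi N - phi M| <= (C + C) *+ k.
Proof.
move=> qC hom; elim=> {k M N} [M|k i j x M N ij st ih|k i j x M N ij st ih] hM.
- by rewrite subrr normr0.
- have := qC _ _ (transv_EL x ij) (elsteps_EL st hM).
  move: (ih hM) (phi_transv x qC hom ij).
  rewrite !ler_norml mulrS => /andP[? ?] /andP[? ?] /andP[? ?].
  by apply/andP; split; lra.
- have := qC _ _ (elsteps_EL st hM) (transv_EL x ij).
  move: (ih hM) (phi_transv x qC hom ij).
  rewrite !ler_norml mulrS => /andP[? ?] /andP[? ?] /andP[? ?].
  by apply/andP; split; lra.
Qed.

(** * A Mennicke-type relation *)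

(** Upper left and lower right 2 by 2 blocks; the two embeddings overlap in the middle
    coordinate. *)
Definition ul3 {A : pzRingType} (a b c d : A) : 'M[A]_3 :=
  mx3 a b 0 c d 0 0 0 1.
Definition lr3 {A : pzRingType} (a b c d : A) : 'M[A]_3 :=
  mx3 1 0 0 0 a b 0 c d.

Lemma ul3_mul (A : pzRingType) (a b c d a' b' c' d' : A) :
  ul3 a b c d *m ul3 a' b' c' d' =
  ul3 (a * a' + b * c') (a * b' + b * d') (c * a' + d * c') (c * b' + d * d').
Proof. by rewrite mx3_mul !(mulr0, mul0r, addr0, add0r, mulr1). Qed.

Lemma lr3_mul (A : pzRingType) (a b c d a' b' c' d' : A) :
  lr3 a b c d *m lr3 a' b' c' d' =
  lr3 (a * a' + b * c') (a * b' + b * d') (c * a' + d * c') (c * b' + d * d').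
Proof. by rewrite mx3_mul !(mulr0, mul0r, addr0, add0r, mulr1). Qed.

(* A quarter turn in the last two coordinates makes the first row of the product
   (a, b b', -a b); one column operation turns this into (a, b b', 0), and the
   remaining operations only clear the other rows. *)
Lemma mennicke_elsteps (A : comPzRingType) (a b c b' c' d e u : A) :
  a * d = 1 + u -> b * c = u -> b' * c' = u -> b * b' * e = u ->
  elsteps 11 (ul3 a b c d *m lr3 a b' c' d) (ul3 a (b * b') e d).
Proof.
move=> ad bc bc' bbe.
pose M1 := ul3 a b c d *m lr3 a b' c' d.
pose M2 := M1 *m transv i1 i2 (-1) *m transv i2 i1 1 *m transv i1 i2 (-1).
pose M3 := transv i2 i1 (- c') *m (M2 *m transv i0 i2 b).
(* The entry -1 of [M3] clears the rest of the middle row; a quarter turn of the last two rows then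
   gives [M5]. *)
pose M4 := M3 *m transv i2 i0 c *m transv i2 i1 (d * b').
pose M5 := transv i1 i2 1 *m (transv i2 i1 (-1) *m (transv i1 i2 1 *m M4)).
have hM2 : M2 = mx3 a (b * b') (- (a * b)) c (d * b') (- (a * d)) 0 d (- c').
  by rewrite /M2 /M1 !transv_mx3 !mx3_mul; congr mx3; ring.
have hM3 : M3 = mx3 a (b * b') 0 c (d * b') (-1) (- (c * c')) (d * (1 - u)) 0.
  rewrite /M3 hM2 !transv_mx3 !mx3_mul; congr mx3; try ring.
  - by ring: ad bc.
  - by ring: bc'.
  - by ring: ad bc.
have hM5 : M5 = ul3 a (b * b') (- (c * c')) (d * (1 - u)).
  by rewrite /M5 /M4 hM3 !transv_mx3 !mx3_mul; congr mx3; ring.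
(* Both matrices have determinant 1 and the same first row, so their quotient is a lower
   transvection; [k] is its lower left entry. *)
pose k := e * (d * (1 - u)) + d * (c * c').
have -> : ul3 a (b * b') e d = transv i1 i0 k *m M5.
  have bbcc : b * b' * (c * c') = u * u by ring: bc bc'.
  have euu : e * (u * u) = u * (c * c').
    by rewrite -bbcc -[in RHS]bbe; ring.
  rewrite hM5 !transv_mx3 mx3_mul /k; congr mx3; try ring.
  - transitivity (e - e * (u * u) + u * (c * c')); first by rewrite euu; ring.
    by ring: ad.
  - transitivity (d * (1 - u) * (1 + b * b' * e) + d * (b * b' * (c * c'))).
      by rewrite bbe bbcc; ring.
    by ring.
do 4 (apply: elsteps_row => //).
do 2 (apply: elsteps_col => //); apply: elsteps_row => //.
by do 4 (apply: elsteps_col => //); exact: elsteps_refl.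
Qed.

(** * Powers of 2 by 2 blocks *)

(* By Cayley-Hamilton, g^n = p + q g whenever \tr g = t and \det g = 1. *)
Fixpoint ch_coef {A : pzRingType} (t : A) (n : nat) : A * A :=
  if n is n'.+1 then
    let: (p, q) := ch_coef t n' in (- q, p + t * q)
  else (1, 0).

(** The left side is the determinant of p + q g when g has trace t and determinant 1. *)
Lemma ch_coef_norm (A : comPzRingType) (t : A) (n : nat) :
  let: (p, q) := ch_coef t n in p * p + t * (p * q) + q * q = 1.
Proof.
elim: n => [|n] /=; first by ring.
by case: (ch_coef t n) => p q <-; ring.
Qed.

Section CayleyHamilton.
Context (A : comPzRingType) (a b c d : A).
Hypothesis det1 : a * d = 1 + b * c.

Lemma ul3_exp (n : nat) :
  let: (p, q) := ch_coef (a + d) n in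
  ul3 a b c d ^+ n = ul3 (p + q * a) (q * b) (q * c) (p + q * d).
Proof.
elim: n => [|n] /=.
  by rewrite expr0 -[LHS]/(1%:M) mx3_one /ul3; congr mx3; ring.
case: (ch_coef _ n) => p q ih; rewrite exprS ih -mulmxE ul3_mul.
by congr ul3; ring: det1.
Qed.

Lemma lr3_exp (n : nat) :
  let: (p, q) := ch_coef (a + d) n in
  lr3 a b c d ^+ n = lr3 (p + q * a) (q * b) (q * c) (p + q * d).
Proof.
elim: n => [|n] /=.
  by rewrite expr0 -[LHS]/(1%:M) mx3_one /lr3; congr mx3; ring.
case: (ch_coef _ n) => p q ih; rewrite exprS ih -mulmxE lr3_mul.
by congr lr3; ring: det1.
Qed.

(** Modulo b the matrix is lower triangular, so the upper left entry of its n-th power becomes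
    a^n. *)
Lemma ch_coef_mod (n : nat) :
  let: (p, q) := ch_coef (a + d) n in exists s, p + q * a = a ^+ n + b * s.
Proof.
elim: n => [|n] /=; first by exists 0; rewrite expr0; ring.
case: (ch_coef _ n) => p q [s hs]; exists (s * a + q * c).
rewrite exprSr.
transitivity ((p + q * a) * a + q * b * c); first by ring: det1.
by rewrite hs; ring.
Qed.
End CayleyHamilton.

Lemma lr3K (A : comPzRingType) (a b c d : A) :
  a * d = 1 + b * c -> lr3 a b c d *m lr3 d (- b) (- c) a = 1%:M.
Proof.
by move=> det1; rewrite mx3_one lr3_mul; congr mx3; ring: det1.
Qed.

(** One column operation changes a into a + b s. The first rows then agree and both determinants are
    1, so one row operation, by [k], does the rest. *)
Lemma ul3_row_elsteps (A : comPzRingType) (a b c d s a' c' d' : A) :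
  a * d = 1 + b * c -> a' * d' = 1 + b * c' -> a' = a + b * s ->
  elsteps 2 (ul3 a b c d) (ul3 a' b c' d').
Proof.
move=> det1 det1' eqa; move: det1'; rewrite {}eqa => det1'.
have det2 : a * d' = 1 + b * c' - b * s * d' by rewrite -det1'; ring.
pose k := c' * d - d' * (c + d * s).
have -> : ul3 (a + b * s) b c' d' =
    transv i1 i0 k *m (ul3 a b c d *m transv i1 i0 s).
  rewrite !transv_mx3 !mx3_mul /k; congr mx3; try ring.
  - transitivity (c' * (1 + b * c) + c' * d * b * s - (c + d * s) * (b * c')).
      by ring.
    by rewrite -det1; ring: det2.
  - transitivity (d * (a * d') - d' * (b * c)); first by ring: det1.
    by rewrite det2; ring.
by apply: elsteps_row => //; apply: elsteps_col => //; exact: elsteps_refl.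
Qed.

Lemma transv_ul3_quarter (A : comPzRingType) :
  transv i0 i1 1 *m transv i1 i0 (-1) *m transv i0 i1 1 = ul3 0 1 (-1) 0
  :> 'M[A]_3.
Proof. by rewrite !transv_mx3 !mx3_mul; congr mx3; ring. Qed.

Lemma ul3_quarter_EL (A : comPzRingType) : EL (ul3 0 1 (-1) 0 : 'M[A]_3).
Proof.
by rewrite -transv_ul3_quarter; do 2?apply: EL_mul; exact: transv_EL.
Qed.

(** * Invariance of [phi] on 3 by 3 matrices *)

Section QuasiHom3.
Context (A : comPzRingType) (R : realType) (phi : 'M[A]_3 -> R) (C : R).
Hypotheses (qC : quasi_hom_bound phi C) (hom : homogeneous phi).

Lemma companion_EL (t : A) : EL (lr3 t 1 (-1) 0).
Proof.
have -> : lr3 t 1 (-1) 0 = transv i1 i2 (1 - t) *m transv i2 i1 (-1) *m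
    transv i1 i2 1.
  by rewrite !transv_mx3 !mx3_mul; congr mx3; ring.
by do 2?apply: EL_mul; exact: transv_EL.
Qed.

(* The companion matrix is conjugate to its inverse by a coordinate swap, which
   the remaining coordinate corrects to determinant 1. *)
Lemma phi_companion (t : A) : phi (lr3 t 1 (-1) 0) = 0.
Proof.
set T := lr3 t 1 (-1) 0.
pose S : 'M[A]_3 := mx3 (-1) 0 0 0 0 1 0 1 0.
have elS : EL S.
  (* The squared quarter turn is diag(-1, -1, 1); it changes a quarter turn of the last two
     coordinates into [S]. *)
  have -> : S = ul3 0 1 (-1) 0 *m ul3 0 1 (-1) 0 *m
      (transv i1 i2 (-1) *m transv i2 i1 1 *m transv i1 i2 (-1)).
    by rewrite !transv_mx3 !mx3_mul; congr mx3; ring.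
  by do 3?apply: EL_mul; try exact: ul3_quarter_EL; exact: transv_EL.
have SS : S *m S = 1%:M.
  by rewrite mx3_one mx3_mul; congr mx3; ring.
have TV : T *m (S *m T *m S) = 1%:M.
  by rewrite mx3_one !mx3_mul; congr mx3; ring.
have VT : S *m T *m S *m T = 1%:M.
  by rewrite mx3_one !mx3_mul; congr mx3; ring.
have := homogeneous_inv hom (companion_EL t) TV VT.
rewrite (homogeneous_conj qC hom (companion_EL t) elS SS SS) -/T.
lra.
Qed.

(** The 23 counts eleven operations at 2C each and one defect for the product X N. *)
Lemma phi_ul3_exp (a b c d : A) (n : nat) :
  a * d = 1 + b * c -> EL (ul3 a b c d) ->
  let: (p, q) := ch_coef (a + d) n in
  let X := ul3 (p + q * a) b (q * q * c) (p + q * d) in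
  EL X /\ `|phi X - n%:R * phi (ul3 a b c d)| <= C *+ 23.
Proof.
move=> det1 elg; rewrite -homogeneous_exp //.
have elgn := EL_exp n elg.
(* [h] has the trace and determinant of g, so its powers have the same p and q; its entry 1 makes it
   conjugate to the companion matrix by a transvection. *)
pose h := lr3 a 1 (b * c) d.
have deth : a * d = 1 + 1 * (b * c) by rewrite mul1r.
have [elh phih] : EL h /\ phi h = 0.
  have elT := companion_EL (a + d).
  have eld := transv_EL d (isT : i2 != i1).
  have -> : h = transv i2 i1 d *m lr3 (a + d) 1 (-1) 0 *m transv i2 i1 (- d).
    by rewrite !transv_mx3 !mx3_mul; congr mx3; ring: det1.
  split; first by apply: EL_mul (EL_mul eld elT) (transv_EL _ _).
  by rewrite (homogeneous_conj qC) ?phi_companion ?transvK ?transvVK.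
have elN := EL_exp n elh.
have phiN : phi (h ^+ n) = 0 by rewrite homogeneous_exp // phih mulr0.
have := ul3_exp det1 n; have := lr3_exp deth n.
have := ch_coef_norm (a + d) n.
case: (ch_coef _ n) => p q nrm hN hg.
rewrite hN mulr1 in elN phiN; rewrite hg in elgn *.
set X := ul3 _ _ _ _.
set N := lr3 _ _ _ _ in elN phiN.
have detN : (p + q * a) * (p + q * d) = 1 + q * (q * (b * c)).
  by rewrite -nrm; ring: det1.
have NN' := lr3K detN.
have N'N : lr3 (p + q * d) (- q) (- (q * (b * c))) (p + q * a) *m N = 1%:M.
  have := @lr3K _ (p + q * d) (- q) (- (q * (b * c))) (p + q * a).
  by rewrite !opprK; apply; rewrite mulrC detN; ring.
have stG : elsteps 11 (X *m N) (ul3 (p + q * a) (q * b) (q * c) (p + q * d)).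
  by rewrite [q * b]mulrC; apply: (mennicke_elsteps detN); ring.
(* Membership of [X] in [EL] is obtained backwards: undo the operations from g^n, then divide by
   [N]. *)
have elXN := elsteps_EL (elsteps_sym stG) elgn.
have elX : EL X.
  have -> : X = X *m N *m lr3 (p + q * d) (- q) (- (q * (b * c))) (p + q * a).
    by rewrite -mulmxA NN' mulmx1.
  by apply: EL_mul elXN (EL_inv elN NN' N'N).
split=> //.
have := phi_elsteps qC hom stG elXN.
have := qC elX elN.
rewrite phiN !ler_norml => /andP[? ?] /andP[? ?].
by apply/andP; split; lra.
Qed.

(** The trace may change, and with it p and q, but both upper left entries p + q a stay congruent to
    a^n modulo b. *)
Lemma phi_ul3_row_lower (a b c d k : A) :
  a * d = 1 + b * c -> EL (ul3 a b c d) ->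
  phi (ul3 a b (c + k * a) (d + k * b)) = phi (ul3 a b c d).
Proof.
move=> det1 elg.
have det1' : a * (d + k * b) = 1 + b * (c + k * a) by ring: det1.
have elg' : EL (ul3 a b (c + k * a) (d + k * b)).
  have -> : ul3 a b (c + k * a) (d + k * b) = transv i1 i0 k *m ul3 a b c d.
    by rewrite !transv_mx3 !mx3_mul; congr mx3; ring.
  by apply: EL_mul => //; exact: transv_EL.
apply/eqP; rewrite -subr_eq0; apply/eqP.
(* Twice 23 from [phi_ul3_exp], plus two operations at 2C each. *)
apply: (@eq0_of_natmul_bounded _ _ (C *+ 50)) => n.
have := phi_ul3_exp n det1 elg; have := phi_ul3_exp n det1' elg'.
have := ch_coef_mod det1 n; have := ch_coef_mod det1' n.
have := ch_coef_norm (a + d) n; have := ch_coef_norm (a + (d + k * b)) n.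
move: (c + k * a) (d + k * b) det1' {elg'} => c' d' det1'.
case: (ch_coef _ n) => p' q' nrm'; case: (ch_coef _ n) => p q nrm.
set X' := ul3 _ _ (_ * c') _; set X := ul3 _ _ (_ * c) _.
move=> [s' hs'] [s hs] [elX' bX'] [elX bX].
have st : elsteps 2 X X'.
  apply: (@ul3_row_elsteps _ _ _ _ _ (s' - s)).
  - by rewrite -nrm; ring: det1.
  - by rewrite -nrm'; ring: det1'.
  - by rewrite hs' hs; ring.
have := phi_elsteps qC hom st elX.
rewrite -[n%:R]ger0_norm // -normrM mulrBr.
move: bX bX'; rewrite !ler_norml => /andP[? ?] /andP[? ?] /andP[? ?].
by apply/andP; split; lra.
Qed.

(** Conjugation by the quarter turn [w] exchanges upper and lower transvections and replaces k by
    -k. *)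
Lemma phi_ul3_row_upper (a b c d k : A) :
  a * d = 1 + b * c -> EL (ul3 a b c d) ->
  phi (ul3 (a + k * c) (b + k * d) c d) = phi (ul3 a b c d).
Proof.
pose w : 'M[A]_3 := ul3 0 1 (-1) 0; pose w' : 'M[A]_3 := ul3 0 (-1) 1 0.
have ww' : w *m w' = 1%:M by rewrite mx3_one mx3_mul; congr mx3; ring.
have w'w : w' *m w = 1%:M by rewrite mx3_one mx3_mul; congr mx3; ring.
have elw : EL w := ul3_quarter_EL A.
have conj x y z t : EL (ul3 x y z t) ->
    EL (ul3 t (- z) (- y) x) /\ phi (ul3 t (- z) (- y) x) = phi (ul3 x y z t).
  move=> el; have <- : w *m ul3 x y z t *m w' = ul3 t (- z) (- y) x.
    by rewrite !mx3_mul; congr mx3; ring.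
  split; last exact: (homogeneous_conj qC).
  by apply: EL_mul (EL_mul elw el) (EL_inv elw ww' w'w).
move=> det1 elg.
have elg' : EL (ul3 (a + k * c) (b + k * d) c d).
  have -> : ul3 (a + k * c) (b + k * d) c d = transv i0 i1 k *m ul3 a b c d.
    by rewrite !transv_mx3 !mx3_mul; congr mx3; ring.
  by apply: EL_mul => //; exact: transv_EL.
have [elh <-] := conj _ _ _ _ elg; have [_ <-] := conj _ _ _ _ elg'.
rewrite -[RHS](@phi_ul3_row_lower _ _ _ _ (- k)) //.
  by congr (phi (ul3 _ _ _ _)); ring.
by rewrite mulrC det1; ring.
Qed.
End QuasiHom3.

(** * Elementary 2 by 2 matrices and corner embeddings *)

Lemma transv_mulE (A : pzRingType) (n p : nat) (i j k : 'I_n) (l : 'I_p)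
    (x : A) (M : 'M[A]_(n, p)) :
  (transv i j x *m M) k l = M k l + x *+ (k == i) * M j l.
Proof.
rewrite mulmxDl mul1mx -scalemxAl !mxE (bigD1 j) //= big1 => [|m mj].
  by rewrite mxE eqxx andbT addr0 mulrA mulr_natr.
by rewrite mxE (negbTE mj) andbF mul0r.
Qed.

Lemma elementary_mx2 (A : pzRingType) (M : 'M[A]_2) :
  elementary_mx M -> exists x : A, M = transv 0 1 x \/ M = transv 1 0 x.
Proof.
move=> [d1 off].
have key (i j : 'I_2) : i != j -> M j i = 0 -> M = transv i j (M i j).
  move=> ij Mji; apply/matrixP => k l; rewrite !mxE.
  have two (m : 'I_2) : m = i \/ m = j.
    by case: i j m ij {Mji} => [[|[|//]] ?] [[|[|//]] ?] [[|[|//]] ?] //= _;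
      [left|right|right|left]; apply: val_inj.
  case: (two k) => ->; case: (two l) => ->;
    rewrite ?eqxx ?(eq_sym j i) ?(negbTE ij) ?andbF;
    rewrite ?mulr0 ?mulr1 ?addr0 ?add0r //.
have [M10|M10] := eqVneq (M 1 0) 0; first by exists (M 0 1); left; exact: key.
exists (M 1 0); right; apply: key => //.
by apply/eqP; apply: contraT => M01; have [] := off 1 0 0 1 isT isT M10 M01.
Qed.

Lemma det_mx22 (A : comPzRingType) (g : 'M[A]_2) :
  \det g = g 0 0 * g 1 1 - g 0 1 * g 1 0.
Proof.
rewrite (expand_det_row _ 0) !big_ord_recl big_ord0 addr0 /cofactor !det_mx11.
rewrite !mxE /= expr0 expr1 mul1r mulN1r mulrN.
by congr (g _ _ * g _ _ - g _ _ * g _ _); apply: val_inj.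
Qed.

Lemma EL2_det (A : comPzRingType) (g : 'M[A]_2) : EL g -> \det g = 1.
Proof.
elim=> {g} [|M /elementary_mx2[x [->|->]]|M N _ hM _ hN|M N _ hM MN _].
- exact: det1.
- by rewrite det_mx22 !mxE !(mulr0, mulr1, addr0, add0r, mul0r, subr0).
- by rewrite det_mx22 !mxE !(mulr0, mulr1, addr0, add0r, mul0r, subr0).
- by rewrite det_mulmx hM hN mulr1.
- by rewrite -[\det N]mul1r -hM -det_mulmx MN det1.
Qed.

(** Sizes are left free because the embedding from dimension 2 into dimension 6 is factored through
    dimension 3. *)
Definition corner {B : pzRingType} (m p : nat) (g : 'M[B]_m) : 'M[B]_(m + p) :=
  block_mx g 0 0 1%:M.

Lemma corner_mul (B : pzRingType) (m p : nat) (g h : 'M[B]_m) :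
  corner p (g *m h) = corner p g *m corner p h.
Proof.
by rewrite mulmx_block !(mulmx0, mul0mx, addr0, add0r, mulmx1).
Qed.

Lemma corner_one (B : pzRingType) (m p : nat) :
  corner p (1%:M : 'M[B]_m) = 1%:M.
Proof. by rewrite /corner -scalar_mx_block. Qed.

Lemma corner_exp (B : pzRingType) (m p : nat) (g : 'M[B]_m) (k : nat) :
  corner p (g ^+ k) = corner p g ^+ k.
Proof.
elim: k => [|k ih]; first exact: corner_one.
by rewrite !exprS -ih -!mulmxE corner_mul.
Qed.

Lemma corner_elementary (B : pzRingType) (m p : nat) (g : 'M[B]_m) :
  elementary_mx g -> elementary_mx (corner p g).
Proof.
move=> [d1 off].
have nz (i j : 'I_(m + p)) : i != j -> corner p g i j != 0 ->
    exists i' j',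
      [/\ i = lshift p i', j = lshift p j', i' != j' & g i' j' != 0].
  rewrite -[i]splitK -[j]splitK; case: split => i'; case: split => j' /=.
  - by rewrite block_mxEul => ij ?; exists i', j'; split=> //;
      apply: contraNneq ij => ->.
  - by rewrite block_mxEur mxE eqxx.
  - by rewrite block_mxEdl mxE eqxx.
  - rewrite block_mxEdr mxE => ij; case: (i' =P j') ij => [->|_ _];
      by rewrite eqxx.
split=> [i|i j k l].
  by rewrite -[i]splitK; case: split => i' /=;
    rewrite ?block_mxEul ?block_mxEdr ?d1 ?mxE ?eqxx.
move=> ij kl /(nz _ _ ij)[i' [j' [-> -> ij' gij]]].
move=> /(nz _ _ kl)[k' [l' [-> -> kl' gkl]]].
by have [-> ->] := off _ _ _ _ ij' kl' gij gkl.
Qed.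

Lemma corner_EL (B : pzRingType) (m p : nat) (g : 'M[B]_m) :
  EL g -> EL (corner p g).
Proof.
elim=> {g} [|M hM|M N _ hM _ hN|M N _ hM MN NM].
- by rewrite corner_one; exact: EL_one.
- by apply: EL_elem; exact: corner_elementary.
- by rewrite corner_mul; exact: EL_mul.
- by apply: EL_inv hM _ _; rewrite -corner_mul ?MN ?NM corner_one.
Qed.

Lemma corner_homogeneous (B : pzRingType) (m p : nat) (R : realType)
    (phi : 'M[B]_(m + p) -> R) :
  homogeneous phi -> homogeneous (fun g : 'M[B]_m => phi (corner p g)).
Proof.
move=> hom g k y elg hy; apply: hom; first exact: corner_EL.
case: k hy => k /=; first by move=> ->; exact: corner_exp.
by rewrite -corner_exp -!corner_mul => -[-> ->]; rewrite corner_one.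
Qed.

Lemma corner_ul3 (A : pzRingType) (g : 'M[A]_2) :
  corner 1 g = ul3 (g 0 0) (g 0 1) (g 1 0) (g 1 1).
Proof.
apply/matrixP => i j; rewrite !mxE; case: splitP => i';
  case: i => [[|[|[|//]]] hi];
  case: i' => [[|[|//]] hi'] //= _; rewrite !mxE; case: splitP => j';
  case: j => [[|[|[|//]]] hj]; case: j' => [[|[|//]] hj'] //= _;
  rewrite ?mxE //=;
  by congr (g _ _); apply: val_inj.
Qed.

Lemma corner26_corner (A : pzRingType) (g : 'M[A]_2) :
  corner26 g = corner 3 (corner 1 g).
Proof.
(* Both bracketings of 2 + 1 + 3 compute to 6, so the cast in block associativity is the
   identity. *)
have := @block_mxA A 2 1 3 2 1 3 g 0 0 0 1%:M 0 0 0 1%:M.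
rewrite row_mx0 col_mx0 -scalar_mx_block => e.
by rewrite /corner26 [LHS]e row_mx0 col_mx0; exact: (@castmx_id A 6 6).
Qed.

(* Left multiplication by a fixed element leaves phi unchanged: this property
   is stable under products and inverses, so elementary matrices suffice. *)
Lemma phi_corner_mull (A : comPzRingType) (R : realType) (phi : 'M[A]_3 -> R)
    (C : R) (g h : 'M[A]_2) :
  quasi_hom_bound phi C -> homogeneous phi -> EL g -> EL h ->
  phi (corner 1 (g *m h)) = phi (corner 1 h).
Proof.
move=> qC hom elg.
elim: elg h => {g} [|M hM|M N _ hM elN hN|M N elM hM MN NM] h elh.
- by rewrite mul1mx.
- have elc := corner_EL 1 elh; rewrite corner_ul3 in elc.
  have det1 : h 0 0 * h 1 1 = 1 + h 0 1 * h 1 0.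
    by rewrite -(EL2_det elh) det_mx22 subrK.
  have [x [->|->]] := elementary_mx2 hM;
    rewrite !corner_ul3 !transv_mulE /= !(mulr0n, mulr1n, mul0r, addr0).
  + exact: (phi_ul3_row_upper qC hom).
  + exact: (phi_ul3_row_lower qC hom).
- by rewrite -mulmxA hM ?hN //; exact: EL_mul.
- rewrite -[in RHS](mul1mx h) -MN -mulmxA hM //.
  by apply: EL_mul elh; exact: EL_inv elM MN NM.
Qed.

Theorem theorem1p5 (A : comPzRingType) (R : realType) (phi : 'M[A]_6 -> R) :
  quasi_hom phi -> homogeneous phi ->
  forall g : 'M[A]_2, EL g -> phi (corner26 g) = 0.
Proof.
move=> [C qC] hom g elg; rewrite corner26_corner.
have qC3 : quasi_hom_bound (fun h : 'M[A]_3 => phi (corner 3 h)) C.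
  move=> h h' elh elh'; rewrite corner_mul.
  exact: qC (corner_EL 3 elh) (corner_EL 3 elh').
have hom3 := corner_homogeneous (m := 3) (p := 3) hom.
(* Invariance is applied at the identity, where [phi] vanishes. *)
have := phi_corner_mull qC3 hom3 elg (EL_one A 2).
by rewrite mulmx1 !corner_one (homogeneous_one hom).
Qed.
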